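(* Consider integers $r,s\ge1$ and $a,b,g,h\ge0$ with $$ab=gh=rs-1,\qquad a+h\equiv b+g\equiv0 \bmod r \ \text{ and }\bmod s,$$ and use the congruences to define two integers $d\ge1$ and $e\ge1$ by $$a+h=ds\quad\text{and}\quad b+g=er.$$ Each solution of these conditions is either one of the exceptional solutions below, or is given by (i) or by (ii) below. Here $c_i=d$ for $i$ odd, $c_i=e$ for $i$ even, and $f_i=e$ for $i$ odd, $f_i=d$ for $i$ even, so that in each product the values $d,e\ge1$ alternate, and the two lines have the same number $k+1$ of factors for some $k\ge1$. (i) $$\begin{pmatrix} r&a\\ b&s\end{pmatrix}=\begin{pmatrix}c_1&-1\\1&0\end{pmatrix}\begin{pmatrix}c_2&-1\\1&0\end{pmatrix}\cdots\begin{pmatrix}c_k&-1\\1&0\end{pmatrix}\begin{pmatrix}0&1\\-1&0\end{pmatrix},$$ $$\begin{pmatrix} r&g\\ h&s\end{pmatrix}=\begin{pmatrix}0&1\\-1&0\end{pmatrix}\begin{pmatrix}0&-1\\1&f_k\end{pmatrix}\cdots\begin{pmatrix}0&-1\\1&f_2\end{pmatrix}\begin{pmatrix}0&-1\\1&f_1\end{pmatrix},$$ or the same with the two left-hand sides exchanged. (ii) $$\begin{pmatrix} r&a\\ b&s\end{pmatrix}=\begin{pmatrix}0&1\\-1&c_1\end{pmatrix}\begin{pmatrix}0&1\\-1&c_2\end{pmatrix}\cdots\begin{pmatrix}0&1\\-1&c_k\end{pmatrix}\begin{pmatrix}0&-1\\1&0\end{pmatrix},$$ $$\begin{pmatrix}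 r&g\\ h&s\end{pmatrix}=\begin{pmatrix}0&-1\\1&0\end{pmatrix}\begin{pmatrix}f_k&1\\-1&0\end{pmatrix}\cdots\begin{pmatrix}f_2&1\\-1&0\end{pmatrix}\begin{pmatrix}f_1&1\\-1&0\end{pmatrix},$$ or the same with the two left-hand sides exchanged. In each case, the values of $d$, $e$ and $k$ that are allowed are constrained only by the following table: $k=1$ if $de=0$; $k\le2$ if $de=1$; $k\le3$ if $de=2$; $k\le5$ if $de=3$; any $k$ if $de\ge4$. Exceptional solutions: the cases $b=g=0$ or $a=h=0$, that is, the matrices $$\begin{pmatrix} r&a\\ b&s\end{pmatrix}=\begin{pmatrix}1&a\\0&1\end{pmatrix}\quad\text{and}\quad\begin{pmatrix} r&g\\ h&s\end{pmatrix}=\begin{pmatrix}1&0\\ h&1\end{pmatrix}$$ for any $a,h\ge0$, or the same with both matrices transposed.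
   Formalization: In (ii) with k even, d and e must be interchanged in the products: (r,s,a,b,g,h)=(2,3,1,5,1,5) has d=2, e=3 and fits no case literally. Conversely, for all table values the products give solutions whose d and e from the congruences are those of the products only up to order. *)

(* Defs.v *)
From mathcomp Require Import all_boot all_order all_algebra.

Set Implicit Arguments.
Unset Strict Implicit.
Unset Printing Implicit Defensive.

Import GRing.Theory.

Local Open Scope ring_scope.

(* The matrix with rows (x, y) and (z, t). *)
Definition mx2 (x y z t : int) : 'M[int]_2 :=
  \matrix_(i < 2, j < 2)
    if i == 0 then (if j == 0 then x else y)
    else (if j == 0 then z else t).

Definition is_solution (r s a b g h : int) : Prop :=
  [/\ [/\ 1 <= r & 1 <= s],
      [/\ 0 <= a, 0 <= b, 0 <= g & 0 <= h],
      [/\ a * b = r * s - 1 & g * h = r * s - 1],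
      [/\ (a + h = 0 %[mod r])%Z & (a + h = 0 %[mod s])%Z] &
      [/\ (b + g = 0 %[mod r])%Z & (b + g = 0 %[mod s])%Z]].

Definition alt (d e : int) (i : nat) : int := if odd i then d else e.

(* In the four products below [alt d e] is the sequence c_i and [alt e d] the
   sequence f_i; in the [_snd] products the index decreases from k to 1. *)
Definition prod_i_fst (d e : int) (k : nat) : 'M[int]_2 :=
  (\prod_(1 <= i < k.+1) mx2 (alt d e i) (-1) 1 0) * mx2 0 1 (-1) 0.

Definition prod_i_snd (d e : int) (k : nat) : 'M[int]_2 :=
  mx2 0 1 (-1) 0 *
  \prod_(i <- rev (index_iota 1 k.+1)) mx2 0 (-1) 1 (alt e d i).

Definition prod_ii_fst (d e : int) (k : nat) : 'M[int]_2 :=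
  (\prod_(1 <= i < k.+1) mx2 0 1 (-1) (alt d e i)) * mx2 0 (-1) 1 0.

Definition prod_ii_snd (d e : int) (k : nat) : 'M[int]_2 :=
  mx2 0 (-1) 1 0 *
  \prod_(i <- rev (index_iota 1 k.+1)) mx2 (alt e d i) 1 (-1) 0.

Definition eq_upto_exchange (A B P Q : 'M[int]_2) : Prop :=
  (A = P /\ B = Q) \/ (B = P /\ A = Q).

Definition given_by_i (d e : int) (k : nat) (r s a b g h : int) : Prop :=
  eq_upto_exchange (mx2 r a b s) (mx2 r g h s)
    (prod_i_fst d e k) (prod_i_snd d e k).

Definition given_by_ii (d e : int) (k : nat) (r s a b g h : int) : Prop :=
  eq_upto_exchange (mx2 r a b s) (mx2 r g h s)
    (prod_ii_fst d e k) (prod_ii_snd d e k).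

(* The case d * e = 0 is only met by exceptional solutions: for all the others
   d and e are positive. *)
Definition allowed (d e : int) (k : nat) : Prop :=
  [/\ [/\ 0 <= d & 0 <= e], (1 <= k)%N &
      [/\ d * e = 0 -> k = 1%N,
          d * e = 1 -> (k <= 2)%N,
          d * e = 2 -> (k <= 3)%N &
          d * e = 3 -> (k <= 5)%N]].

Definition is_exceptional (r s a b g h : int) : Prop :=
  exists x y : int,
    [/\ 0 <= x, 0 <= y &
        (mx2 r a b s = mx2 1 x 0 1 /\ mx2 r g h s = mx2 1 0 y 1) \/
        (mx2 r a b s = (mx2 1 x 0 1)^T /\ mx2 r g h s = (mx2 1 0 y 1)^T)].

(* Main.v *)
Require Import Defs.
From mathcomp Require Import all_boot all_order all_algebra.
From mathcomp Require Import zify ring.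

Import Order.TTheory GRing.Theory Num.Theory.

Local Open Scope ring_scope.

(** Let K_n(d,e) be the continuant of n - 1 terms d, e, d, ...  The products
    in (i) are the matrices (K_k(d,e), K_(k+1)(d,e); K_(k-1)(e,d), K_k(e,d)) and
    (K_k(d,e), K_(k+1)(e,d); K_(k-1)(d,e), K_k(e,d)), and those in (ii) are their
    conjugates by the coordinate swap.  Conversely, since (bh)(ag) = (rs-1)^2, up
    to that conjugation a solution has bh < rs.  If rs > 1, stripping the first
    factor of the first product and the last factor of the second one replaces
    (r,s,a,b,g,h) by (b,h,s,db-r,r,eh-s), again a solution, with d and e
    interchanged, with rs replaced by bh, and with the inequality preserved; the
    descent ends at r = s = 1. *)

(** * Continuants of alternating sequences and their signs *)

Fixpoint continuant (d e : int) (n : nat) : int :=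
  match n with
  | 0 => 0
  | n'.+1 => match n' with
             | 0 => 1
             | m.+1 => d * continuant e d n' - continuant d e m
             end
  end.

Lemma continuantSS (d e : int) (n : nat) :
  continuant d e n.+2 = d * continuant e d n.+1 - continuant d e n.
Proof. by []. Qed.

Lemma continuant_det (d e : int) (n : nat) :
  continuant d e n.+1 * continuant e d n.+1
    - continuant d e n.+2 * continuant e d n = 1.
Proof.
elim: n d e => [|n IH] d e; first by rewrite /=; ring.
rewrite -(IH e d) (continuantSS d e n.+1) (continuantSS d e n); ring.
Qed.

(** For odd n the continuant is a polynomial in [d * e]; for even n it is [d] times such a
    polynomial. This is the source of every parity distinction below. *)
Lemma continuant_swap (d e : int) (n : nat) :
  if odd n then continuant d e n = continuant e d n
  else e * continuant d e n = d * continuant e d n.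
Proof.
suff: (if odd n then continuant d e n = continuant e d n
       else e * continuant d e n = d * continuant e d n) /\
      (if odd n.+1 then continuant d e n.+1 = continuant e d n.+1
       else e * continuant d e n.+1 = d * continuant e d n.+1) by case.
elim: n => [|n [IH1 IH2]]; first by rewrite /= !mulr0.
split=> //; rewrite !oddS negbK !(continuantSS _ _ n) in IH2 *.
case: (odd n) IH1 IH2 => [IH1 <-|IH1 ->]; first by rewrite IH1.
by rewrite !mulrBr IH1; ring.
Qed.

(** The second bound carries the induction: multiplied by [d], its instance for [e], [d] gives 4
    K_n(d,e) <= de K_n(d,e) < 2d K_(n+1)(e,d), so subtracting K_n(d,e) from d K_(n+1)(e,d) removes
    less than half of it. *)
Lemma continuant_growth (d e : int) (n : nat) :
  0 < d -> 0 < e -> 4 <= d * e ->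
  0 <= continuant d e n /\ d * continuant e d n < 2 * continuant d e n.+1.
Proof.
elim: n d e => [|n IH] d e d0 e0 de; first by rewrite /= !mulr0 mulr1.
have [P0 P1] := IH d e d0 e0 de.
have ed : 4 <= e * d by rewrite mulrC.
have [Q0 Q1] := IH e d e0 d0 ed.
rewrite (continuantSS d e n); split; first by nia.
have dQ : d * (e * continuant d e n) < d * (2 * continuant e d n.+1).
  by rewrite ltr_pM2l.
have tP := ler_wpM2r P0 de.
lia.
Qed.

(** For [d * e] at least 4 this follows from the growth bound. Below 4 the table leaves finitely
    many k, and at the largest one for [d * e] = 1, 2, 3 the last continuant is exactly 0. *)
Lemma allowed_continuant (d e : int) (k : nat) :
  allowed d e k.+1 ->
  [/\ 0 <= continuant d e k, 1 <= continuant d e k.+1 &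
      0 <= continuant d e k.+2].
Proof.
move=> [[d0 e0] _ [k0 k1 k2 k3]].
have [t4|t4] := lerP 4 (d * e).
  have [dp ep] : 0 < d /\ 0 < e.
    by case: (eqVneq d 0) (eqVneq e 0) t4 => [->|dn] [->|en] t4; split; lia.
  have t4' : 4 <= e * d by rewrite mulrC.
  have [P0 P1] := @continuant_growth d e k dp ep t4.
  have [Q0 _] := @continuant_growth e d k ep dp t4'.
  have [P2 _] := @continuant_growth d e k.+2 dp ep t4.
  have dQ : 0 <= d * continuant e d k by rewrite mulr_ge0.
  by split=> //; lia.
have de_cases : [\/ d * e = 0, d * e = 1, d * e = 2 | d * e = 3].
  have : 0 <= d * e by rewrite mulr_ge0.
  move: (d * e) t4 => t t4 t0.
  have [] : (t = 0 \/ t = 1) \/ (t = 2 \/ t = 3) by lia.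
    by case; [constructor 1|constructor 2].
  by case; [constructor 3|constructor 4].
case: de_cases => t.
- move: (k0 t) => [->]; rewrite /=; split; lia.
- by move: (k1 t); case: k {k0 k1 k2 k3} => [|[|]] //= _; split; lia.
- by move: (k2 t); case: k {k0 k1 k2 k3} => [|[|[|]]] //= _; split; nia.
- by move: (k3 t); case: k {k0 k1 k2 k3} => [|[|[|[|[|]]]]] //= _; split; nia.
Qed.

Lemma allowedC (d e : int) (k : nat) : allowed d e k -> allowed e d k.
Proof. by rewrite /allowed mulrC; case=> [[]]. Qed.

(** * Closed forms of the four products *)

Lemma mx2_inj (x y z t x' y' z' t' : int) :
  mx2 x y z t = mx2 x' y' z' t' -> [/\ x = x', y = y', z = z' & t = t'].
Proof.
move/matrixP=> E.
by move: (E 0 0) (E 0 1) (E 1 0) (E 1 1); rewrite !mxE.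
Qed.

Lemma mul_mx2 (x y z t x' y' z' t' : int) :
  mx2 x y z t * mx2 x' y' z' t' =
  mx2 (x * x' + y * z') (x * y' + y * t') (z * x' + t * z') (z * y' + t * t').
Proof.
apply/matrixP=> i j; rewrite !mxE !big_ord_recl big_ord0 addr0 !mxE /=.
by case: (i == 0); case: (j == 0).
Qed.

Lemma tr_mx2 (x y z t : int) : (mx2 x y z t)^T = mx2 x z y t.
Proof. by apply/matrixP=> i j; rewrite !mxE; case: (i == 0); case: (j == 0). Qed.

Lemma alt_succ (d e : int) (i : nat) : alt d e i.+1 = alt e d i.
Proof. by rewrite /alt oddS; case: (odd i). Qed.

Lemma iotaS_map (k : nat) :
  index_iota 1 k.+2 = 1%N :: map succn (index_iota 1 k.+1).
Proof. by rewrite /index_iota !subn1 /= -(iotaDl 1). Qed.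

(** Removing the factor of index 1 shifts the other indices by one, which interchanges [d] and [e].
    In the [_snd] products that factor is the last one. *)
Lemma prod_i_fstS (d e : int) (k : nat) :
  prod_i_fst d e k.+1 = mx2 d (-1) 1 0 * prod_i_fst e d k.
Proof.
rewrite /prod_i_fst iotaS_map big_cons big_map -mulrA; congr (_ * (_ * _)).
by apply: eq_bigr => i _; rewrite alt_succ.
Qed.

Lemma prod_i_sndS (d e : int) (k : nat) :
  prod_i_snd d e k.+1 = prod_i_snd e d k * mx2 0 (-1) 1 e.
Proof.
rewrite /prod_i_snd iotaS_map rev_cons -map_rev big_rcons big_map /= mulrA.
congr (_ * _ * _).
by apply: eq_bigr => i _; rewrite alt_succ.
Qed.

Lemma prod_ii_fstS (d e : int) (k : nat) :
  prod_ii_fst d e k.+1 = mx2 0 1 (-1) d * prod_ii_fst e d k.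
Proof.
rewrite /prod_ii_fst iotaS_map big_cons big_map -mulrA; congr (_ * (_ * _)).
by apply: eq_bigr => i _; rewrite alt_succ.
Qed.

Lemma prod_ii_sndS (d e : int) (k : nat) :
  prod_ii_snd d e k.+1 = prod_ii_snd e d k * mx2 e 1 (-1) 0.
Proof.
rewrite /prod_ii_snd iotaS_map rev_cons -map_rev big_rcons big_map /= mulrA.
congr (_ * _ * _).
by apply: eq_bigr => i _; rewrite alt_succ.
Qed.

Lemma prod_i_fstE (d e : int) (k : nat) :
  prod_i_fst d e k.+1 =
  mx2 (continuant d e k.+1) (continuant d e k.+2)
      (continuant e d k) (continuant e d k.+1).
Proof.
elim: k d e => [|k IH] d e; rewrite prod_i_fstS.
  by rewrite /prod_i_fst big_nil mul1r mul_mx2 /=; congr mx2; ring.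
by rewrite IH mul_mx2 (continuantSS d e k.+1) (continuantSS d e k);
  congr mx2; ring.
Qed.

Lemma prod_i_sndE (d e : int) (k : nat) :
  prod_i_snd d e k.+1 =
  mx2 (continuant d e k.+1) (continuant e d k.+2)
      (continuant d e k) (continuant e d k.+1).
Proof.
elim: k d e => [|k IH] d e; rewrite prod_i_sndS.
  by rewrite /prod_i_snd big_nil mulr1 mul_mx2 /=; congr mx2; ring.
by rewrite IH mul_mx2 (continuantSS e d k.+1) (continuantSS e d k);
  congr mx2; ring.
Qed.

Lemma prod_ii_fstE (d e : int) (k : nat) :
  prod_ii_fst d e k.+1 =
  mx2 (continuant e d k.+1) (continuant e d k)
      (continuant d e k.+2) (continuant d e k.+1).
Proof.
elim: k d e => [|k IH] d e; rewrite prod_ii_fstS.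
  by rewrite /prod_ii_fst big_nil mul1r mul_mx2 /=; congr mx2; ring.
by rewrite IH mul_mx2 (continuantSS d e k.+1) (continuantSS d e k);
  congr mx2; ring.
Qed.

Lemma prod_ii_sndE (d e : int) (k : nat) :
  prod_ii_snd d e k.+1 =
  mx2 (continuant e d k.+1) (continuant d e k)
      (continuant e d k.+2) (continuant d e k.+1).
Proof.
elim: k d e => [|k IH] d e; rewrite prod_ii_sndS.
  by rewrite /prod_ii_snd big_nil mulr1 mul_mx2 /=; congr mx2; ring.
by rewrite IH mul_mx2 (continuantSS e d k.+1) (continuantSS e d k);
  congr mx2; ring.
Qed.

(** * The descent and the bounds of the table *)

Lemma mulz_eq1 (x y : int) : 1 <= x -> 1 <= y -> x * y = 1 -> x = 1 /\ y = 1.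
Proof. nia. Qed.

Lemma mulz_eq0_pos (x y : int) : 0 < x -> x * y = 0 -> y = 0.
Proof. by move=> x0 /eqP; rewrite mulf_eq0 gt_eqF // => /eqP. Qed.

(* A solution of type (i) yields [d s = m r] and [e r = n s], with [m = d] and
   [n = e] for [k] odd but [m = e] and [n = d] for [k] even; carrying [m] and [n]
   along makes the congruences pass to the smaller solution. *)
Lemma descent (r s a b g h d e m n : int) :
  1 <= r -> 1 <= s -> 0 <= a -> 0 <= b -> 0 <= g -> 0 <= h ->
  a * b = r * s - 1 -> g * h = r * s - 1 ->
  a + h = d * s -> a + h = m * r -> b + g = e * r -> b + g = n * s ->
  b * h < r * s -> 1 <= a + h -> 1 <= b + g ->
  exists k : nat,
    [/\ mx2 r a b s = prod_i_fst d e k.+1, mx2 r g h s = prod_i_snd d e k.+1 &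
        forall j : nat, (j <= k)%N ->
          1 <= continuant d e j.+1 /\ 1 <= continuant e d j.+1].
Proof.
have [N] := ubnP (absz (r * s)).
elim: N r s a b g h d e m n => // N IH r s a b g h d e m n rsN r1 s1.
move=> a0 b0 g0 h0 ab gh ahd ahm bge bgn bh_lt ah1 bg1.
have [bh0|bh_neq0] := eqVneq (b * h) 0.
  have rs1 : r * s = 1.
    suff : a * b * (g * h) = 0.
      by rewrite ab gh => /eqP; rewrite mulf_eq0 orbb => /eqP; lia.
    have -> : a * b * (g * h) = a * g * (b * h) by ring.
    by rewrite bh0 mulr0.
  have [r_1 s_1] : r = 1 /\ s = 1 by apply: mulz_eq1.
  subst r s.
  (* Positivity of the two sums enters here: if b = 0 then g > 0, and gh = 0 forces h = 0; likewise
     with h, a and b. *)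
  have [b_0 h_0] : b = 0 /\ h = 0.
    move/eqP: bh0; rewrite mulf_eq0 => /orP[] /eqP z; subst; split=> //.
      by apply: (@mulz_eq0_pos g) => //; lia.
    by apply: (@mulz_eq0_pos a); lia.
  subst b h; exists 0%N.
  rewrite prod_i_fstE prod_i_sndE /=.
  split; [congr mx2; lia|congr mx2; lia|].
  by case.
have bp : 1 <= b by move: bh_neq0; rewrite mulf_eq0; case: eqVneq => //=; lia.
have hp : 1 <= h by move: bh_neq0; rewrite mulf_eq0 orbC; case: eqVneq => //=; lia.
(* The sums of the smaller solution are eh and db; this identity and the next make each a multiple
   of both b and h. *)
have ehm : e * h = m * b.
  apply: (mulIf (_ : r != 0)); first by lia.
  have -> : e * h * r = (b + g) * h by rewrite bge; ring.
  have -> : m * b * r = (a + h) * b by rewrite ahm; ring.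
  by rewrite !mulrDl gh ab; ring.
have dbn : d * b = n * h.
  apply: (mulIf (_ : s != 0)); first by lia.
  have -> : d * b * s = (a + h) * b by rewrite ahd; ring.
  have -> : n * h * s = (b + g) * h by rewrite bgn; ring.
  by rewrite !mulrDl gh ab; ring.
have det1 : s * (d * b - r) = b * h - 1.
  have -> : s * (d * b - r) = d * s * b - r * s by ring.
  by rewrite -ahd mulrDl ab; ring.
have det2 : r * (e * h - s) = b * h - 1.
  have -> : r * (e * h - s) = e * r * h - r * s by ring.
  by rewrite -bge mulrDl gh; ring.
have bh1 : 0 <= b * h - 1 by move: (mulr_ge0 b0 h0) bh_neq0; lia.
have b'0 : 0 <= d * b - r by rewrite -(pmulr_rge0 _ (_ : 0 < s)) ?det1 //; lia.
have h'0 : 0 <= e * h - s by rewrite -(pmulr_rge0 _ (_ : 0 < r)) ?det2 //; lia.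
have b'h'_lt : (d * b - r) * (e * h - s) < b * h.
  (* By the two determinant identities the claim times rs reads (bh - 1)^2 < rs bh, which follows
     from 1 <= bh < rs. *)
  rewrite -(@ltr_pM2l _ (r * s)); last by lia.
  have -> : r * s * ((d * b - r) * (e * h - s)) = (b * h - 1) * (b * h - 1).
    by rewrite -{1}det1 -det2; ring.
  have yx : 0 <= r * s - b * h by lia.
  by move: (b * h) (r * s) bh1 bh_lt yx (mulr_ge0 bh1 yx) => x y; lia.
have bhN : (absz (b * h)%R < N)%N by lia.
have [k [Efst Esnd pos]] :
  exists k : nat,
    [/\ mx2 b s (d * b - r) h = prod_i_fst e d k.+1,
        mx2 b r (e * h - s) h = prod_i_snd e d k.+1 &
        forall j : nat, (j <= k)%N ->
          1 <= continuant e d j.+1 /\ 1 <= continuant d e j.+1].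
  by apply: (IH b h s (d * b - r) r (e * h - s) e d m n) => //; lia.
have Ffst : mx2 r a b s = prod_i_fst d e k.+2.
  by rewrite prod_i_fstS -Efst mul_mx2; congr mx2; lia.
exists k.+1; split=> //.
  by rewrite prod_i_sndS -Esnd mul_mx2; congr mx2; lia.
move=> j; rewrite leq_eqVlt => /orP[/eqP->|/pos[]//].
(* The two new continuants are the diagonal entries r and s. *)
by move: Ffst; rewrite prod_i_fstE => /mx2_inj[<- _ _ <-].
Qed.

(** The table stops before the first zero: K_3, K_4, K_6 have the factors de - 1, de - 2, de - 3,
    with roots 4 cos^2(pi/n) for n = 3, 4, 6. *)
Lemma allowed_of_continuant_gt0 (d e : int) (k : nat) :
  1 <= d -> 1 <= e ->
  (forall j : nat, (j <= k)%N -> 1 <= continuant d e j.+1) ->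
  allowed d e k.+1.
Proof.
move=> d1 e1 pos; split; [by split; lia|by []|].
have K3 : continuant d e 3 = d * e - 1 by rewrite /=; ring.
have K4 : continuant d e 4 = d * (d * e - 2) by rewrite /=; ring.
have K6 : continuant d e 6 = d * ((d * e - 1) * (d * e - 3)) by rewrite /=; ring.
split=> t; first by nia.
- by rewrite leqNgt; apply/negP => /(pos 2); rewrite K3 t.
- by rewrite leqNgt; apply/negP => /(pos 3); rewrite K4 t mulr0.
- by rewrite leqNgt; apply/negP => /(pos 5); rewrite K6 t !mulr0.
Qed.

(** * Exceptional solutions and the classification *)

Lemma is_exceptionalP (r s a b g h : int) :
  is_exceptional r s a b g h <->
  is_solution r s a b g h /\ ((b = 0 /\ g = 0) \/ (a = 0 /\ h = 0)).
Proof.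
split.
  move=> [x [y [x0 y0 E]]].
  rewrite !tr_mx2 in E.
  by case: E => -[/mx2_inj[-> -> -> ->] /mx2_inj[_ -> -> _]];
    (split; [split; split; rewrite ?modz1 //; lia|auto]).
move=> [[[r1 s1] [a0 b0 g0 h0] [ab gh] _ _] Z].
have [r_1 s_1] : r = 1 /\ s = 1.
  have rs1 : r * s = 1 by case: Z => -[z1 z2]; move: ab; rewrite z1; lia.
  by apply: mulz_eq1.
subst r s; case: Z => -[z1 z2]; subst.
  by exists a, h; split=> //; left.
by exists b, g; split=> //; right; rewrite !tr_mx2.
Qed.

Lemma solution_of_products (r s a b g h d e m n : int) :
  1 <= r -> 1 <= s -> 0 <= a -> 0 <= b -> 0 <= g -> 0 <= h ->
  a * b = r * s - 1 -> g * h = r * s - 1 ->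
  a + h = d * s -> a + h = m * r -> b + g = e * r -> b + g = n * s ->
  is_solution r s a b g h.
Proof.
move=> r1 s1 a0 b0 g0 h0 ab gh ahd ahm bge bgn.
have modM x y : (x * y = 0 %[mod y])%Z by rewrite modzMl mod0z.
by split; split=> //; [rewrite ahm|rewrite ahd|rewrite bge|rewrite bgn].
Qed.

Theorem theorem3p3 :
  (* every solution is exceptional or given by (i) or (ii) for allowed values;
     the d and e of the congruences are those of the products, except that
     they are interchanged in (ii) when k is even *)
  (forall r s a b g h d e : int,
     is_solution r s a b g h -> a + h = d * s -> b + g = e * r ->
     is_exceptional r s a b g h \/
     [/\ 1 <= d, 1 <= e &
         exists k : nat, allowed d e k /\
           (given_by_i d e k r s a b g h \/
            (if odd k then given_by_ii d e k r s a b g h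
             else given_by_ii e d k r s a b g h))]) /\
  (* all allowed values occur in (i) and in (ii), and only give solutions,
     whose d and e are those of the products up to order *)
  (forall (d e : int) (k : nat),
     allowed d e k ->
     [/\ exists r s a b g h : int, given_by_i d e k r s a b g h,
         exists r s a b g h : int, given_by_ii d e k r s a b g h &
         forall r s a b g h : int,
           given_by_i d e k r s a b g h \/ given_by_ii d e k r s a b g h ->
           is_solution r s a b g h /\
           ((a + h = d * s /\ b + g = e * r) \/
            (a + h = e * s /\ b + g = d * r))]) /\
  (* the exceptional matrices are exactly the solutions with
     b = g = 0 or a = h = 0 *)
  (forall r s a b g h : int,
     is_exceptional r s a b g h <->
     is_solution r s a b g h /\ ((b = 0 /\ g = 0) \/ (a = 0 /\ h = 0))).
Proof.
split; last split; last exact: is_exceptionalP.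
- move=> r s a b g h d e sol ahd bge.
  have [[r1 s1] [a0 b0 g0 h0] [ab gh] [ahr _] [_ bgs]] := sol.
  have [ah0|ah_neq0] := eqVneq (a + h) 0.
    by left; apply/is_exceptionalP; split=> //; right; lia.
  have [bg0|bg_neq0] := eqVneq (b + g) 0.
    by left; apply/is_exceptionalP; split=> //; left; lia.
  have ah1 : 1 <= a + h by lia.
  have bg1 : 1 <= b + g by lia.
  have [m ahm] : exists m, a + h = m * r.
    by apply/dvdzP/dvdz_mod0P; rewrite ahr mod0z.
  have [n bgn] : exists n, b + g = n * s.
    by apply/dvdzP/dvdz_mod0P; rewrite bgs mod0z.
  have d1 : 1 <= d.
    have : 0 < d * s by lia.
    by rewrite pmulr_lgt0 //; lia.
  have e1 : 1 <= e.
    have : 0 < e * r by lia.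
    by rewrite pmulr_lgt0 //; lia.
  right; split=> //.
  have [bh_lt|rs_le] := ltrP (b * h) (r * s).
    have [k [Efst Esnd pos]] := descent _ _ _ _ _ _ _ _ _ _
      r1 s1 a0 b0 g0 h0 ab gh ahd ahm bge bgn bh_lt ah1 bg1.
    exists k.+1; split; last by left; left.
    by apply: allowed_of_continuant_gt0 => // j /pos[].
  (* Otherwise (rs)^2 <= (ag)(bh) = (rs - 1)^2. The conjugate solution (s,r,b,a,h,g), with [d] and
     [e] interchanged, then satisfies the inequality of the descent. *)
  have ag_lt : a * g < r * s.
    rewrite ltNge; apply/negP => rs_le'.
    have rs0 : 0 < r * s by rewrite mulr_gt0 //; lia.
    have := ler_pM (ltW rs0) (ltW rs0) rs_le' rs_le.
    have -> : a * g * (b * h) = (a * b) * (g * h) by ring.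
    by rewrite ab gh; move: (r * s) rs0 => x; lia.
  have [k [Efst Esnd pos]] : exists k : nat,
    [/\ mx2 s b a r = prod_i_fst e d k.+1, mx2 s h g r = prod_i_snd e d k.+1 &
        forall j : nat, (j <= k)%N ->
          1 <= continuant e d j.+1 /\ 1 <= continuant d e j.+1].
    by apply: (@descent s r b a h g e d n m) => //; lia.
  exists k.+1; split.
    by apply: allowed_of_continuant_gt0 => // j /pos[].
  right; move: Efst Esnd; rewrite prod_i_fstE prod_i_sndE.
  move=> /mx2_inj[-> -> -> ->] /mx2_inj[_ -> -> _].
  (* The products (ii) for [e], [d] fit without exchange. When the index is odd, the symmetry of the
     diagonal continuants makes them the exchanged products for [d], [e]. *)
  have := continuant_swap d e k.+1; case: ifP => _ swap.
    by right; rewrite prod_ii_fstE prod_ii_sndE swap.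
  by left; rewrite prod_ii_fstE prod_ii_sndE.
- move=> d e [|k] dek; first by case: dek.
  rewrite /given_by_i /given_by_ii prod_i_fstE prod_i_sndE prod_ii_fstE
    prod_ii_sndE.
  have [P0 P1 P2] := allowed_continuant _ _ _ dek.
  have [Q0 Q1 Q2] := allowed_continuant _ _ _ (allowedC _ _ _ dek).
  have detP := continuant_det d e k.
  have detQ := continuant_det e d k.
  have recP := continuantSS d e k.
  have recQ := continuantSS e d k.
  have := continuant_swap d e k.+1.
  move: (continuant d e k) (continuant d e k.+1) (continuant d e k.+2)
    (continuant e d k) (continuant e d k.+1) (continuant e d k.+2)
    P0 P1 P2 Q0 Q1 Q2 detP detQ recP recQ.
  move=> p0 p1 p2 q0 q1 q2 P0 P1 P2 Q0 Q1 Q2 detP detQ recP recQ.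
  have first_sum : p2 + p0 = d * q1 by lia.
  have second_sum : q2 + q0 = e * p1 by lia.
  move=> swap; split; [by do 6 eexists; left|by do 6 eexists; left|].
  move=> r s a b g h E.
  have {E} E : [\/ [/\ r = p1, s = q1 & [/\ a = p2, b = q0, g = q2 & h = p0]],
                   [/\ r = p1, s = q1 & [/\ a = q2, b = p0, g = p2 & h = q0]],
                   [/\ r = q1, s = p1 & [/\ a = q0, b = p2, g = p0 & h = q2]] |
                   [/\ r = q1, s = p1 & [/\ a = p0, b = q2, g = q0 & h = p2]]].
    case: E => -[] [/mx2_inj[-> -> -> ->] /mx2_inj[_ -> -> _]];
      by [constructor 1|constructor 2|constructor 3|constructor 4].
  (* The sums d q1 and e p1 must be multiples of both p1 and q1: either p1 = q1, or d q1 = e p1. *)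
  case: ifP swap => _ swap; [subst q1|];
  case: E => -[-> -> [-> -> -> ->]]; split; try lia;
  first [ by apply: (solution_of_products _ _ _ _ _ _ d e d e); lia
        | by apply: (solution_of_products _ _ _ _ _ _ d e e d); lia
        | by apply: (solution_of_products _ _ _ _ _ _ e d e d); lia
        | by apply: (solution_of_products _ _ _ _ _ _ e d d e); lia ].
Qed.
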